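(* Let $q_\varepsilon(t)$ be a space change of the trajectory $t\mapsto q(t)$, $t\in I$. Suppose that the total derivative condition is satisfied with the smooth scalar function $\psi(t,q,\dot q)$, that there exists a vector-valued function $\varphi(t,q,\dot q)\in\mathbb{R}^n$ such that $$\partial_\varepsilon q_\varepsilon(t)\big|_{\varepsilon=0}=\varphi\bigl(t,q(t),\dot q(t)\bigr)\qquad\forall t\in I,$$ and that $t\mapsto q(t)$ is a solution to the Lagrange equation. Then the function $$(t,q,\dot q)\mapsto\partial_{\dot q}L(t,q,\dot q)\cdot\varphi(t,q,\dot q)-\psi(t,q,\dot q)$$ is constant if evaluated along $q(t)$, i.e. at $(t,q(t),\dot q(t))$, $t\in I$.
   Context: Let $n\ge1$ and let $L=L(t,q,\dot q)$ (the Lagrangian) be a smooth real-valued function on an open subset of $\mathbb{R}\times\mathbb{R}^n\times\mathbb{R}^n$. The symbols $\partial_qL,\partial_{\dot q}L$ denote the gradients with respect to the second and third arguments, viewed as vectors of $\mathbb{R}^n$; $x\cdot y$ is the Euclidean inner product; a dot over a function denotes the derivative in $t$. The functions $\psi$ and $\varphi$ are defined on the domain of $L$. Let $t\mapsto q(t)\in\mathbb{R}^n$ be a smooth trajectory on an open interval $I$ such that $(t,q(t),\dot q(t))$ lies in the domain of $L$ for all $t\in I$. It is a solution to the Lagrange equation if $\frac{d}{dt}\partial_{\dot q}L(t,q(t),\dot q(t))-\partial_qL(t,q(t),\dot q(t))=0$ for all $t\in I$. A space change of $q$ is a smooth one-parameter family $(\varepsilon,t)\mapsto q_\varepsilon(t)\in\mathbb{R}^n$,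 defined on an open neighbourhood of $\{0\}\times I$ in $\mathbb{R}\times I$ (i.e. for $t\in I$ and $\varepsilon$ close to $0$), with $q_0(t)=q(t)$ for all $t\in I$; $\dot q_\varepsilon(t)$ denotes $\partial_tq_\varepsilon(t)$. The total derivative condition is satisfied with $\psi$ if $$\Bigl(\frac{\partial}{\partial\varepsilon}L\bigl(t,q_\varepsilon(t),\dot q_\varepsilon(t)\bigr)\Bigr)\Big|_{\varepsilon=0}=\frac{d}{dt}\psi\bigl(t,q(t),\dot q(t)\bigr)\quad\forall t\in I.$$ *)

(* Defs.v *)
From HB Require Import structures.
From mathcomp Require Import all_boot all_order all_algebra.
From mathcomp Require Import all_classical all_reals all_analysis.

Set Implicit Arguments.
Unset Strict Implicit.
Unset Printing Implicit Defensive.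

Import Order.TTheory GRing.Theory Num.Theory.
Import numFieldNormedType.Exports.

Local Open Scope classical_set_scope.
Local Open Scope ring_scope.

(* C^k regularity on an open set D.  For f : V -> W with V finite dimensional
   (the only case used here), the iterated derivatives of f are continuous iff
   all iterated directional derivatives are.  The values of f outside D are
   irrelevant, since D is open. *)
Fixpoint Ck (R : realType) (V W : normedModType R) (k : nat) (D : set V)
    (f : V -> W) : Prop :=
  match k with
  | 0%N => forall x, D x -> {for x, continuous f}
  | k'.+1 => (forall x, D x -> differentiable f x) /\
             (forall v : V, Ck k' D (fun x => 'D_v f x))
  end.

Definition smooth_on (R : realType) (V W : normedModType R) (D : set V)
    (f : V -> W) : Prop :=
  forall k, Ck k D f.

Definition dot (R : realType) (n : nat) (u v : 'rV[R]_n) : R :=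
  \sum_(i < n) u 0 i * v 0 i.

Definition gradient (R : realType) (n : nat) (f : 'rV[R]_n -> R)
    (x : 'rV[R]_n) : 'rV[R]_n :=
  \row_(i < n) 'D_(delta_mx 0 i) f x.

(* A point of phase R n is a triple (t, q, q'), that is ((t, q), q'). *)
Definition phase (R : realType) (n : nat) : normedModType R :=
  (R * 'rV[R]_n * 'rV[R]_n)%type.

Definition grad_q (R : realType) (n : nat) (L : phase R n -> R)
    (z : phase R n) : 'rV[R]_n :=
  gradient (fun x => L (z.1.1, x, z.2)) z.1.2.

Definition grad_v (R : realType) (n : nat) (L : phase R n -> R)
    (z : phase R n) : 'rV[R]_n :=
  gradient (fun v => L (z.1.1, z.1.2, v)) z.2.

Definition jet (R : realType) (n : nat) (q : R -> 'rV[R]_n) (t : R) :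
    phase R n :=
  (t, q t, derive1 q t).

Definition trajectory (R : realType) (n : nat) (U : set (phase R n))
    (I : set R) (q : R -> 'rV[R]_n) : Prop :=
  smooth_on I q /\ (forall t, I t -> U (jet q t)).

(* derive1 is total; the derivatives below exist because the functions involved
   are smooth near the points considered. *)
Definition lagrange_solution (R : realType) (n : nat) (L : phase R n -> R)
    (I : set R) (q : R -> 'rV[R]_n) : Prop :=
  forall t, I t ->
    derive1 (fun s => grad_v L (jet q s)) t - grad_q L (jet q t) = 0.

(* The first argument of qe is the parameter epsilon. *)
Definition space_change (R : realType) (n : nat) (I : set R)
    (q : R -> 'rV[R]_n) (qe : R -> R -> 'rV[R]_n) : Prop :=
  exists W : set (R * R)%type,
    [/\ open W,
        [set 0] `*` I `<=` W,
        W `<=` [set: R] `*` I,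
        smooth_on W (fun z : R * R => qe z.1 z.2) &
        forall t, I t -> qe 0 t = q t].

Definition total_derivative_condition (R : realType) (n : nat)
    (L psi : phase R n -> R) (I : set R) (q : R -> 'rV[R]_n)
    (qe : R -> R -> 'rV[R]_n) : Prop :=
  forall t, I t ->
    derive1 (fun e => L (jet (qe e) t)) 0 = derive1 (fun s => psi (jet q s)) t.

(* Main.v *)
Require Import Defs.
From HB Require Import structures.
From mathcomp Require Import all_boot all_order all_algebra.
From mathcomp Require Import all_classical all_reals all_analysis.

Import Order.TTheory GRing.Theory Num.Theory.
Import numFieldNormedType.Exports.

Local Open Scope classical_set_scope.
Local Open Scope ring_scope.

(** Write eta(t) for the velocity of q_e(t) in e at e = 0; along q it equals phi.
    At a point z of phase space the differential of L, applied to a vector with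
    no time component, is
      dL(0, x, v) = grad_q L . x + grad_v L . v          ([derive_phase]).
    Apply this to the curve e |-> jet (q_e) t, whose velocity at e = 0 is
    (0, eta(t), d/de d/dt q_e(t)).  Equality of mixed partial derivatives
    turns the last component into eta'(t), so that the total derivative condition
    reads
      d/dt psi = grad_q L . eta + grad_v L . eta'   ([space_change_variation]).
    By the Lagrange equation grad_q L is the time derivative of the momentum
    grad_v L along q ([is_derive_momentum]); hence the right-hand side is
    d/dt (grad_v L . eta) by the product rule.  The quantity
    grad_v L . phi - psi therefore has zero derivative on the interval I, and the
    mean value theorem makes it constant ([is_derive0_interval_cst]).

    Equality of mixed partials ([derive_sym]) is proved by the classical
    argument: both are limits of one symmetric second difference quotient, each
    obtained from it by two applications of the mean value theorem
    ([second_difference]).  The mean value theorem needs real values, so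
    vector-valued maps are treated one coordinate at a time
    ([derive_sym_rV]). *)

(** * Derivatives along curves *)

Lemma is_derive_along (R : realType) (V W : normedModType R) (c : R -> V)
    (dc : V) (f : V -> W) (t : R) :
  is_derive t 1 c dc -> differentiable f (c t) ->
  is_derive t 1 (fun s => f (c s)) ('D_dc f (c t)).
Proof.
move=> [/derivable1_diffP dct <-] df.
have dfc : differentiable (f \o c) t by exact: differentiable_comp.
apply: DeriveDef; first exact/derivable1_diffP.
by rewrite (deriveE _ df) (deriveE _ dct) [LHS]deriveE// diff_comp.
Qed.

Lemma is_derive_line (R : realType) (V : normedModType R) (x u : V) (t : R) :
  is_derive t 1 (fun s : R => x + s *: u) u.
Proof.
have [dl dlE] : is_diff t (cst x + (fun s : R => s *: u)) (0 + (fun s : R => s *: u)).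
  exact: is_diffD.
apply: DeriveDef; first exact/diff_derivable/dl.
by rewrite deriveE // dlE add0r scale1r.
Qed.

Lemma is_derive_pair (R : realType) (V W : normedModType R) (f : R -> V)
    (g : R -> W) (t : R) (df : V) (dg : W) :
  is_derive t 1 f df -> is_derive t 1 g dg ->
  is_derive t 1 (fun s => (f s, g s)) (df, dg).
Proof.
move=> [/derivable1_diffP dft <-] [/derivable1_diffP dgt <-].
apply: DeriveDef; first exact/diff_derivable/differentiable_pair.
rewrite deriveE; last exact: differentiable_pair.
by rewrite diff_pair// !deriveE.
Qed.

Lemma is_derive_coord (R : realType) (V : normedModType R) (m n : nat)
    (M : V -> 'M[R]_(m, n)) (x v : V) (dM : 'M[R]_(m, n)) i j :
  is_derive x v M dM -> is_derive x v (fun y => M y i j) (dM i j).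
Proof.
move=> [Mx <-]; apply: DeriveDef; first exact: (derivable_mxP _ _ _).1.
by rewrite derive_mx// mxE.
Qed.

Lemma is_derive_dot (R : realType) (n : nat) (p w : R -> 'rV[R]_n) (t : R)
    (dp dw : 'rV[R]_n) :
  is_derive t 1 p dp -> is_derive t 1 w dw ->
  is_derive t 1 (fun s => dot (p s) (w s)) (dot dp (w t) + dot (p t) dw).
Proof.
move=> hp hw.
have -> : (fun s => dot (p s) (w s)) =
    \sum_(i < n) ((fun s => p s 0 i) * (fun s => w s 0 i)).
  by apply/funext => s; rewrite /dot fct_sumE.
apply: is_derive_eq.
  apply: is_derive_sum => i; apply: is_deriveM; exact: is_derive_coord.
rewrite /dot -big_split/=; apply: eq_bigr => i _.
by rewrite addrC ![_ *: _]mulrC mulrC.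
Qed.

(** A directional derivative only sees the restriction of [f] to a line, so it
    is computed without any regularity of [f] as soon as [c] maps the line through
    [y] in direction [u] to the line through [c y] in direction [w], at unit rate.
    This covers every partial derivative used below. *)
Lemma derive_affine (R : realType) (V0 V W : normedModType R) (f : V -> W)
    (c : V0 -> V) (y u : V0) (w : V) :
  (forall h : R, c (h *: u + y) = h *: w + c y) ->
  'D_u (fun x => f (c x)) y = 'D_w f (c y).
Proof.
move=> cE; rewrite /derive; set f1 := (fun h : R => _); set f2 := (fun h : R => _).
by suff -> : f1 = f2 by []; apply/funext => h; rewrite /f1 /f2 /= cE.
Qed.

Lemma is_derive_horizontal (R : realType) (e t : R) :
  is_derive e 1 (fun s : R => (s, t)) ((1, 0) : R * R).
Proof. exact: is_derive_pair. Qed.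

Lemma is_derive_vertical (R : realType) (e t : R) :
  is_derive t 1 (fun s : R => (e, s)) ((0, 1) : R * R).
Proof. exact: is_derive_pair. Qed.

Lemma derive1_horizontal (R : realType) (V : normedModType R) (f : R -> R -> V)
    (e t : R) :
  derive1 (fun s => f s t) e = 'D_((1, 0) : R * R) (fun z => f z.1 z.2) (e, t).
Proof.
rewrite derive1E.
apply: (@derive_affine _ _ _ _ (fun z : R * R => f z.1 z.2) (fun s => (s, t))) => h.
by congr (_, _); rewrite /= ?scaler0 ?add0r.
Qed.

Lemma derive1_vertical (R : realType) (V : normedModType R) (f : R -> R -> V)
    (e t : R) :
  derive1 (f e) t = 'D_((0, 1) : R * R) (fun z => f z.1 z.2) (e, t).
Proof.
rewrite derive1E.
apply: (@derive_affine _ _ _ _ (fun z : R * R => f z.1 z.2) (fun s => (e, s))) => h.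
by congr (_, _); rewrite /= ?scaler0 ?add0r.
Qed.

(** * Mean value theorem *)

Lemma is_derive0_interval_cst (R : realType) (I : set R) (f : R -> R) :
  is_interval I -> (forall t, I t -> is_derive t 1 f 0) ->
  forall s t, I s -> I t -> f s = f t.
Proof.
move=> iI df.
suff le_eq s t : s <= t -> I s -> I t -> f s = f t.
  move=> s t Is It; have [st|/ltW ts] := leP s t; first exact: le_eq.
  by apply/esym; exact: le_eq.
move=> st Is It.
have Iu u : u \in `[s, t]%R -> I u.
  by rewrite in_itv/= => sut; exact: (iI s t).
have [u ust| |u _] := @MVT_segment _ f (cst 0) s t st.
- by apply: df; apply: Iu; exact: subset_itv_oo_cc ust.
- apply: derivable_within_continuous => u ust.
  by have [] := df _ (Iu _ ust).
by rewrite mul0r => /eqP; rewrite subr_eq0 => /eqP.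
Qed.

Lemma MVT_line (R : realType) (V : normedModType R) (f : V -> R) (x u : V)
    (h : R) :
  0 < h -> (forall s, 0 <= s <= h -> differentiable f (x + s *: u)) ->
  exists2 s, 0 < s < h & f (x + h *: u) - f x = h * 'D_u f (x + s *: u).
Proof.
move=> h0 df.
have dfl s : 0 <= s <= h ->
    is_derive s 1 (fun s => f (x + s *: u)) ('D_u f (x + s *: u)).
  by move=> /df; apply: is_derive_along; exact: is_derive_line.
have [s| |s sh] := @MVT _ (fun s => f (x + s *: u))
    (fun s => 'D_u f (x + s *: u)) 0 h h0.
- by rewrite in_itv/= => /andP[/ltW s0 /ltW sh]; apply: dfl; rewrite s0 sh.
- apply: derivable_within_continuous => s; rewrite in_itv/= => /dfl dfs.
  exact: (@ex_derive _ _ _ _ _ _ _ dfs).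
rewrite scale0r addr0 subr0 mulrC => fE.
by exists s => //; rewrite in_itv in sh.
Qed.

(** * Symmetry of second derivatives *)

(** With g y = f (y + h v) - f y, the second difference is g (x + h u) - g x.
    The mean value theorem in direction [u] produces
    h (fu (x + a u + h v) - fu (x + a u)), and a second use, in direction [v],
    produces the mixed derivative.  The left-hand side is symmetric in [u] and
    [v], which is what makes [derive_sym] work.

    The first derivative enters through a function [fu] that agrees with it only
    on the parallelogram: differentiability of [fu] can then be checked on a
    formula for the derivative, such as a coordinate of the derivative of a
    vector-valued map. *)
Lemma second_difference (R : realType) (V : normedModType R) (f fu : V -> R)
    (x u v : V) (h : R) : 0 < h ->
  (forall a b, 0 <= a <= h -> 0 <= b <= h ->
    let y := x + a *: u + b *: v in
    [/\ differentiable f y, 'D_u f y = fu y & differentiable fu y]) ->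
  exists a b, [/\ 0 < a < h, 0 < b < h &
    (f (x + h *: u + h *: v) - f (x + h *: v)) - (f (x + h *: u) - f x) =
    h * (h * 'D_v fu (x + a *: u + b *: v))].
Proof.
move=> h0 df.
have h0h : 0 <= h <= h by rewrite lexx ltW.
have z0h : 0 <= (0 : R) <= h by rewrite lexx ltW.
pose g y := f (y + h *: v) - f y.
have sh y : is_diff y (fun y : V => y + h *: v) id.
  have -> : (fun y : V => y + h *: v) = id + cst (h *: v) by [].
  by apply: is_diff_eq; rewrite addr0.
have dg1 a : 0 <= a <= h -> differentiable (fun y => f (y + h *: v)) (x + a *: u).
  move=> ah; apply: (@differentiable_comp _ _ _ _ (fun y : V => y + h *: v) f) => //.
  by have [] := df _ _ ah h0h.
have dg2 a : 0 <= a <= h -> differentiable f (x + a *: u).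
  by move=> ah; have [+ _ _] := df _ _ ah z0h; rewrite scale0r addr0.
have [a ah ga] : exists2 a, 0 < a < h &
    g (x + h *: u) - g x = h * 'D_u g (x + a *: u).
  by apply: MVT_line => // a ah; apply: differentiableB; [exact: dg1|exact: dg2].
have ah' : 0 <= a <= h by case/andP : ah => *; rewrite !ltW.
have [b bh gb] : exists2 b, 0 < b < h &
    fu (x + a *: u + h *: v) - fu (x + a *: u) =
    h * 'D_v fu (x + a *: u + b *: v).
  by apply: MVT_line => // b bh; have [] := df _ _ ah' bh.
exists a, b; split => //.
have -> : h * 'D_v fu (x + a *: u + b *: v) = 'D_u g (x + a *: u).
  rewrite -gb [RHS](@deriveB _ _ _ (fun y => f (y + h *: v)) f); last 2 first.
  - exact/diff_derivable/dg1.
  - exact/diff_derivable/dg2.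
  (* The derivative of g in direction u is fu (y + h v) - fu y. *)
  have [_ fu0 _] := df _ _ ah' z0h; have [dfh fuh _] := df _ _ ah' h0h.
  rewrite scale0r addr0 in fu0; rewrite fu0 -fuh; congr (_ - _).
  rewrite [RHS]deriveE; last exact: dg1.
  rewrite (@diff_comp _ _ _ _ (fun y : V => y + h *: v) f)//=.
  by rewrite diff_val -deriveE.
by rewrite -ga /g !opprB addrACA [RHS]addrACA [- _ - _ in LHS]addrC.
Qed.

Lemma near_parallelogram (R : realType) (V : normedModType R) (x u v : V)
    (P : V -> Prop) :
  (\forall y \near x, P y) ->
  exists2 h, 0 < h & forall a b : R, 0 <= a <= h -> 0 <= b <= h ->
    P (x + a *: u + b *: v).
Proof.
move=> /nbhs_ballP[e /= e0 eP].
(* The ratio below keeps |a u + b v| under e; adding 1 makes the bound strict and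
   the denominator nonzero when u = v = 0. *)
have n0 : 0 < `|u| + `|v| + 1 by rewrite ltr_wpDl// addr_ge0.
exists (e / (`|u| + `|v| + 1)); first by rewrite divr_gt0.
set h := e / _ => a b /andP[a0 ah] /andP[b0 bh]; apply: eP.
have h0 : 0 < h by rewrite divr_gt0.
rewrite -ball_normE /ball_/= -addrA opprD addrA subrr sub0r normrN.
apply: (@le_lt_trans _ _ (h * (`|u| + `|v|))).
  rewrite (le_trans (ler_normD _ _))// !normrZ (ger0_norm a0) (ger0_norm b0).
  by rewrite mulrDr lerD// ler_wpM2r.
rewrite -[ltRHS](@divfK _ (`|u| + `|v| + 1)) ?gt_eqF// -/h ltr_pM2l//.
by rewrite ltrDl.
Qed.

(** The two second differences, taken in the orders u, v and v, u, are the same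
    number.  Hence the two mixed derivatives take a common value at some pair of
    points of an arbitrarily small parallelogram, and continuity at [x] brings
    both of them back to [x]. *)
Lemma derive_sym (R : realType) (V : normedModType R) (f fu fv : V -> R)
    (x u v : V) :
  (\forall y \near x, [/\ differentiable f y,
     'D_u f y = fu y, differentiable fu y, 'D_v f y = fv y &
     differentiable fv y]) ->
  {for x, continuous (fun y => 'D_v fu y)} ->
  {for x, continuous (fun y => 'D_u fv y)} ->
  'D_v fu x = 'D_u fv x.
Proof.
move=> df cuv cvu; set A := LHS; set B := RHS.
apply/eqP; rewrite -subr_eq0 -normr_le0; apply/ler_addgt0Pl => e e0.
have e20 : 0 < e / 2 by rewrite divr_gt0.
move/cvgrPdist_lt : cuv => /(_ _ e20) near1.
move/cvgrPdist_lt : cvu => /(_ _ e20) near2.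
have [h h0 H] := @near_parallelogram _ _ x u v _ (filterI (filterI near1 near2) df).
have [|a [b [ah bh E1]]] := @second_difference _ _ f fu x u v h h0.
  by move=> a b ah bh; have [_ []] := H _ _ ah bh.
have [|b' [a' [bh' ah' E2]]] := @second_difference _ _ f fv x v u h h0.
  by move=> c d ch dh; rewrite addrAC; have [_ []] := H _ _ dh ch.
have {E1 E2} E : 'D_v fu (x + a *: u + b *: v) =
    'D_u fv (x + a' *: u + b' *: v).
  apply/(mulfI (lt0r_neq0 h0))/(mulfI (lt0r_neq0 h0)).
  rewrite -[LHS]E1 (addrAC x (a' *: u)) -[RHS]E2 (addrAC x (h *: v)).
  by rewrite !opprB addrACA [RHS]addrACA [- _ - _ in LHS]addrC.
have w c : 0 < c < h -> 0 <= c <= h by move=> /andP[/ltW -> /ltW ->].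
have [[AM _] _] := H _ _ (w _ ah) (w _ bh).
have [[_ BM] _] := H _ _ (w _ ah') (w _ bh').
move: AM BM; rewrite /= -E -/A -/B.
move: ('D_v _ (x + a *: u + b *: v)) => M AM BM.
move: A B AM BM => A B AM BM {H near1 near2 E}.
rewrite [leRHS]addr0; apply: le_trans (ler_distD M _ _) _.
by rewrite ltW// [ltRHS]splitr ltrD// distrC.
Qed.

Lemma near_eq_continuous_at (T U : topologicalType) (f g : T -> U) (x : T) :
  (\forall y \near x, f y = g y) ->
  {for x, continuous f} -> {for x, continuous g}.
Proof.
move=> fg cf; rewrite /prop_for /continuous_at -(nbhs_singleton fg).
exact: cvg_trans (near_eq_cvg fg) cf.
Qed.

Lemma smooth_differentiable (R : realType) (V W : normedModType R) (D : set V)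
    (f : V -> W) (x : V) :
  smooth_on D f -> D x -> differentiable f x.
Proof. by move=> sf; exact: (sf 1%N).1. Qed.
Arguments smooth_differentiable {R V W D f x}.

Lemma smooth_on_derive (R : realType) (V W : normedModType R) (D : set V)
    (f : V -> W) (v : V) :
  smooth_on D f -> smooth_on D (fun x => 'D_v f x).
Proof. by move=> sf k; exact: (sf k.+1).2. Qed.
Arguments smooth_on_derive {R V W D f}.

(** [derive_sym] for each coordinate of [f], the first derivatives being given by
    the coordinates of the derivatives of [f]. *)
Lemma derive_sym_rV (R : realType) (V : normedModType R) (n : nat)
    (f : V -> 'rV[R]_n) (D : set V) (x u v : V) :
  open D -> smooth_on D f -> D x ->
  'D_v (fun z => 'D_u f z) x = 'D_u (fun z => 'D_v f z) x.
Proof.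
move=> oD sf Dx.
have nD : \forall z \near x, D z by exact: open_nbhs_nbhs.
have df y : D y -> differentiable f y by exact: (sf 1%N).1.
have ddf w y : D y -> differentiable (fun z => 'D_w f z) y.
  by have [_ /(_ w)[+ _]] := sf 2%N; exact.
have cddf w w' : {for x, continuous (fun y => 'D_w' (fun z => 'D_w f z) y)}.
  by have [_ /(_ w)[_ /(_ w')]] := sf 2%N; exact.
have coordE (g : V -> 'rV[R]_n) i w y : differentiable g y ->
    'D_w (fun z => g z 0 i) y = 'D_w g y 0 i.
  by move=> dg; rewrite derive_mx ?mxE//; exact: diff_derivable.
have dcoord (g : V -> 'rV[R]_n) i y : differentiable g y ->
    differentiable (fun z => g z 0 i) y.
  move=> dg; apply: (@differentiable_comp _ _ _ _ g (fun N : 'rV[R]_n => N 0 i)) => //.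
  exact: differentiable_coord.
have cddf_coord i w w' :
    {for x, continuous (fun y => 'D_w' (fun z => 'D_w f z 0 i) y)}.
  apply: (@near_eq_continuous_at _ _ (fun y => 'D_w' (fun z => 'D_w f z) y 0 i)).
    by apply: filterS nD => y Dy; rewrite (coordE (fun z => 'D_w f z))//; exact: ddf.
  apply: (@continuous_comp _ _ _ (fun y => 'D_w' (fun z => 'D_w f z) y)
    (fun N : 'rV[R]_n => N 0 i)); first exact: cddf.
  exact: coord_continuous.
apply/rowP => i.
have uvE := coordE (fun z => 'D_u f z) i v x (ddf u x Dx).
have vuE := coordE (fun z => 'D_v f z) i u x (ddf v x Dx).
apply: (etrans (esym uvE)); apply: (etrans _ vuE).
apply: (@derive_sym _ _ (fun z => f z 0 i)).
- apply: filterS nD => y Dy; split.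
  + exact/dcoord/df.
  + exact/coordE/df.
  + exact/(dcoord (fun z => 'D_u f z))/ddf.
  + exact/coordE/df.
  + exact/(dcoord (fun z => 'D_v f z))/ddf.
- exact: cddf_coord.
- exact: cddf_coord.
Qed.

(** * Phase space and the gradients of the Lagrangian *)

Lemma grad_qE (R : realType) (n : nat) (L : phase R n -> R) (z : phase R n) i :
  grad_q L z 0 i = 'D_((0, delta_mx 0 i, 0) : phase R n) L z.
Proof.
case: z => [[t x] v]; rewrite mxE.
apply: (@derive_affine _ _ _ _ L (fun x => (t, x, v))) => h.
by congr (_, _, _); rewrite /= ?scaler0 ?add0r.
Qed.

Lemma grad_vE (R : realType) (n : nat) (L : phase R n -> R) (z : phase R n) i :
  grad_v L z 0 i = 'D_((0, 0, delta_mx 0 i) : phase R n) L z.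
Proof.
case: z => [[t x] v]; rewrite mxE.
apply: (@derive_affine _ _ _ _ L (fun v => (t, x, v))) => h.
by congr (_, _, _); rewrite /= ?scaler0 ?add0r.
Qed.

(** The differential of [L] is linear, and its values on the coordinate vectors
    of the position and velocity factors are the entries of the two gradients. *)
Lemma derive_phase (R : realType) (n : nat) (L : phase R n -> R) (z : phase R n)
    (x v : 'rV[R]_n) : differentiable L z ->
  'D_((0, x, v) : phase R n) L z = dot (grad_q L z) x + dot (grad_v L z) v.
Proof.
move=> dL.
have xE : ((0, x, 0) : phase R n) =
    \sum_(i < n) x 0 i *: ((0, delta_mx 0 i, 0) : phase R n).
  rewrite {1}(row_sum_delta x) (big_morph (fun w => (0, w, 0) : phase R n)
    (id1 := 0) (op1 := +%R)) => [|y w|//]; last by congr (_, _, _); rewrite /= ?addr0.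
  by apply: eq_bigr => i _; congr (_, _, _); rewrite /= ?scaler0.
have vE : ((0, 0, v) : phase R n) =
    \sum_(i < n) v 0 i *: ((0, 0, delta_mx 0 i) : phase R n).
  rewrite {1}(row_sum_delta v) (big_morph (fun w => (0, 0, w) : phase R n)
    (id1 := 0) (op1 := +%R)) => [|y w|//]; last by congr (_, _, _); rewrite /= ?addr0.
  by apply: eq_bigr => i _; congr (_, _, _); rewrite /= ?scaler0.
have -> : ((0, x, v) : phase R n) = ((0, x, 0) : phase R n) + (0, 0, v).
  by congr (_, _, _); rewrite /= ?addr0 ?add0r.
rewrite deriveE// linearD/= xE vE !linear_sum /dot.
by congr (_ + _); apply: eq_bigr => i _; rewrite linearZ/= ?grad_qE ?grad_vE deriveE// mulrC.
Qed.

(** * Variation of the Lagrangian along a trajectory *)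

Lemma derivable_jet (R : realType) (n : nat) (I : set R) (q : R -> 'rV[R]_n)
    (t : R) :
  smooth_on I q -> I t -> derivable (jet q) t 1.
Proof.
move=> sq It.
have dq : derivable q t 1.
  exact/diff_derivable/(smooth_differentiable sq It).
have ddq : derivable (derive1 q) t 1.
  have -> : derive1 q = (fun x => 'D_1 q x) by apply/funext => x; rewrite derive1E.
  have ddq := smooth_differentiable (smooth_on_derive (1 : R) sq) It.
  exact: diff_derivable ddq.
have [] : is_derive t 1 (jet q)
    (((1 : R), derive1 q t, derive1 (derive1 q) t) : phase R n) => //.
apply: is_derive_pair; first apply: is_derive_pair.
- by rewrite derive1E; exact: derivableP.
- by rewrite (derive1E (derive1 q)); exact: derivableP.
Qed.

(** The equation alone does not give this, because [derive1] is total: the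
    smoothness of [L] and of the trajectory shows that the momentum is derivable,
    and the Lagrange equation then identifies its derivative. *)
Lemma is_derive_momentum (R : realType) (n : nat) (U : set (phase R n))
    (L : phase R n -> R) (I : set R) (q : R -> 'rV[R]_n) (t : R) :
  smooth_on U L -> trajectory U I q -> lagrange_solution L I q -> I t ->
  is_derive t 1 (fun s => grad_v L (jet q s)) (grad_q L (jet q t)).
Proof.
move=> sL [sq qU] lag It; apply: DeriveDef; last first.
  by rewrite -derive1E; apply/eqP; rewrite -subr_eq0; exact/eqP/lag.
apply/derivable_mxP => i j; rewrite (ord1 i).
have -> : (fun s => grad_v L (jet q s) 0 j) =
    (fun s => 'D_((0, 0, delta_mx 0 j) : phase R n) L (jet q s)).
  by apply/funext => s; exact: grad_vE.
have [] // := @is_derive_along _ _ _ (jet q) ('D_1 (jet q) t)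
  (fun z => 'D_((0, 0, delta_mx 0 j) : phase R n) L z) t.
  exact/derivableP/(derivable_jet _ _ I).
exact: (smooth_differentiable (smooth_on_derive _ sL) (qU _ It)).
Qed.

(** The velocity component of the curve e |-> jet (q_e) t moves, at e = 0, with
    the derivative in e of the time derivative of q_e(t).  Exchanging the two
    derivatives expresses it as the time derivative [deta] of the variation field,
    the form in which the product rule for grad_v L . eta can use it. *)
Lemma space_change_variation (R : realType) (n : nat) (U : set (phase R n))
    (L : phase R n -> R) (I : set R) (q : R -> 'rV[R]_n)
    (qe : R -> R -> 'rV[R]_n) (t : R) :
  smooth_on U L -> open I -> trajectory U I q -> space_change I q qe -> I t ->
  exists2 deta : 'rV[R]_n,
    is_derive t 1 (fun s => derive1 (fun e => qe e s) 0) deta &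
    derive1 (fun e => L (jet (qe e) t)) 0 =
      dot (grad_q L (jet q t)) (derive1 (fun e => qe e t) 0) +
      dot (grad_v L (jet q t)) deta.
Proof.
move=> sL oI [_ qU] [W [oW IW _ sQ q0]] It.
have W0t : W (0, t) by exact: IW.
set Q : R * R -> 'rV[R]_n := fun z => qe z.1 z.2 in sQ *.
(* q_0 and q agree on the neighbourhood I of t, hence so do their velocities. *)
have jet0 : jet (qe 0) t = jet q t.
  rewrite /jet q0// !derive1E; congr (_, _).
  by apply: near_eq_derive; apply: filterS (open_nbhs_nbhs (conj oI It)).
have dQ := smooth_differentiable sQ W0t.
have dDQ v := smooth_differentiable (smooth_on_derive v sQ) W0t.
exists ('D_((0, 1) : R * R) (fun z => 'D_((1, 0) : R * R) Q z) (0, t)).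
  have -> : (fun s => derive1 (fun e => qe e s) 0) =
      (fun s => 'D_((1, 0) : R * R) Q (0, s)).
    by apply/funext => s; exact: derive1_horizontal.
  apply: (@is_derive_along _ _ _ (fun s : R => (0 : R, s)) ((0, 1) : R * R)
    (fun z => 'D_((1, 0) : R * R) Q z)); last exact: dDQ.
  exact: is_derive_vertical.
have -> : derive1 (fun e => qe e t) 0 = 'D_((1, 0) : R * R) Q (0, t).
  exact: derive1_horizontal.
rewrite (derive_sym_rV _ _ _ Q W)// -derive_phase; last first.
  exact: (smooth_differentiable sL (qU _ It)).
rewrite derive1E -jet0.
have djet : is_derive (0 : R) 1 (fun e => jet (qe e) t)
    ((0, 'D_((1, 0) : R * R) Q (0, t),
      'D_((1, 0) : R * R) (fun z => 'D_((0, 1) : R * R) Q z) (0, t)) : phase R n).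
  have -> : (fun e => jet (qe e) t) =
      (fun e => (t, Q (e, t), 'D_((0, 1) : R * R) Q (e, t)) : phase R n).
    by apply/funext => e; rewrite /jet derive1_vertical.
  apply: is_derive_pair; first apply: is_derive_pair.
  - apply: (@is_derive_along _ _ _ (fun e : R => (e, t)) ((1, 0) : R * R) Q) => //.
    exact: is_derive_horizontal.
  - apply: (@is_derive_along _ _ _ (fun e : R => (e, t)) ((1, 0) : R * R)
      (fun z => 'D_((0, 1) : R * R) Q z)); last exact: dDQ.
    exact: is_derive_horizontal.
have dL : differentiable L (jet (qe 0) t).
  by rewrite jet0; exact: (smooth_differentiable sL (qU _ It)).
by have [] := @is_derive_along _ _ _ (fun e => jet (qe e) t) _ L 0 djet dL.
Qed.

Theorem theorem4 (R : realType) (n : nat) (hn : (1 <= n)%N)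
    (U : set (phase R n)) (hU : open U)
    (L : phase R n -> R) (hL : smooth_on U L)
    (I : set R) (hIopen : open I) (hIint : is_interval I)
    (q : R -> 'rV[R]_n) (hq : trajectory U I q)
    (qe : R -> R -> 'rV[R]_n) (hqe : space_change I q qe)
    (psi : phase R n -> R) (hpsi : smooth_on U psi)
    (htd : total_derivative_condition L psi I q qe)
    (phi : phase R n -> 'rV[R]_n)
    (hphi : forall t, I t -> derive1 (fun e => qe e t) 0 = phi (jet q t))
    (hlag : lagrange_solution L I q) :
  exists c : R, forall t, I t ->
    dot (grad_v L (jet q t)) (phi (jet q t)) - psi (jet q t) = c.
Proof.
pose N t := dot (grad_v L (jet q t)) (phi (jet q t)) - psi (jet q t).
suff dN t : I t -> is_derive t 1 N 0.
  have [[t0 It0]|I0] := pselect (exists t, I t); last first.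
    by exists 0 => t It; case: I0; exists t.
  by exists (N t0) => t It; exact: (is_derive0_interval_cst _ I N).
move=> It.
have [deta etaE varL] := space_change_variation _ _ _ _ _ _ _ _ hL hIopen hq hqe It.
have [sq qU] := hq.
have dpsi : derivable (fun s => psi (jet q s)) t 1.
  have [] // := @is_derive_along _ _ _ (jet q) ('D_1 (jet q) t) psi t.
    exact/derivableP/(derivable_jet _ _ I).
  exact: (smooth_differentiable hpsi (qU _ It)).
(* phi carries no regularity of its own; along q it agrees on the open set I with
   the variation field, which is derivable. *)
apply: (@near_eq_is_derive _ _ _
  ((fun s => dot (grad_v L (jet q s)) (derive1 (fun e => qe e s) 0)) -
   (fun s => psi (jet q s)))).
  apply: filterS (open_nbhs_nbhs (conj hIopen It)) => s Is.
  by rewrite /N -hphi.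
have dp := is_derive_momentum _ _ _ _ _ _ _ hL hq hlag It.
apply: is_derive_eq.
  apply: is_deriveB; first exact: is_derive_dot dp etaE.
  exact: derivableP.
by rewrite -varL htd// derive1E subrr.
Qed.
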